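(* For every infinite cardinal $\kappa\le\mathfrak{c}$ there exists a family $\mathcal{T}_\kappa\subset\mathcal{L}$ with $|\mathcal{T}_\kappa|=2^\kappa$ such that for each $\tau\in\mathcal{T}_\kappa$ the space $(\mathbb{R},\tau)$ is a completely normal Baire space of weight $\kappa$, and for distinct $\tau,\tau'\in\mathcal{T}_\kappa$ the spaces $(\mathbb{R},\tau)$ and $(\mathbb{R},\tau')$ are not homeomorphic.
   Context: $\mathfrak{c}=|\mathbb{R}|$. $\eta$ denotes the Euclidean topology on $\mathbb{R}$. $\mathcal{L}$ denotes the family of all Hausdorff topologies $\tau$ on $\mathbb{R}$ with $\tau\subset\eta$. The weight of a space is the least cardinality of a base of its topology. *)

(* Defs.v *)
From HB Require Import structures.
From mathcomp Require Import all_boot all_order all_algebra.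
From mathcomp Require Import all_classical all_reals all_analysis.
From mathcomp Require Import Rstruct Rstruct_topology.
From Stdlib Require Import Reals.
Set Implicit Arguments. Unset Strict Implicit. Unset Printing Implicit Defensive.
Local Open Scope classical_set_scope.

Definition is_topology (tau : set (set R)) : Prop :=
  [/\ tau set0, tau setT,
      (forall U V, tau U -> tau V -> tau (U `&` V)) &
      (forall (I : Type) (F : I -> set R), (forall i, tau (F i)) ->
         tau (\bigcup_(i in [set: I]) F i))].

Definition eta_top : set (set R) := [set A | open A].

Definition hausdorff_top (tau : set (set R)) : Prop :=
  forall x y : R, x <> y ->
    exists U V, [/\ tau U, tau V, U x, V y & U `&` V = set0].

Definition in_L (tau : set (set R)) : Prop :=
  [/\ is_topology tau, hausdorff_top tau & tau `<=` eta_top].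

Definition closed_in (tau : set (set R)) (F : set R) : Prop := tau (~` F).

Definition normal_subspace (tau : set (set R)) (Y : set R) : Prop :=
  forall A B : set R,
    (exists F, closed_in tau F /\ A = Y `&` F) ->
    (exists G, closed_in tau G /\ B = Y `&` G) ->
    A `&` B = set0 ->
    exists U V, [/\ tau U, tau V, A `<=` U, B `<=` V & Y `&` U `&` V = set0].

(** Completely (= hereditarily) normal: every subspace is normal
    (T1 is automatic here since all spaces considered are Hausdorff). *)
Definition completely_normal (tau : set (set R)) : Prop :=
  forall Y : set R, normal_subspace tau Y.

Definition dense_in (tau : set (set R)) (D : set R) : Prop :=
  forall U, tau U -> U !=set0 -> (U `&` D) !=set0.

Definition baire (tau : set (set R)) : Prop :=
  forall U : nat -> set R, (forall n, tau (U n) /\ dense_in tau (U n)) ->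
    dense_in tau (\bigcap_(n in [set: nat]) U n).

Definition is_base (tau : set (set R)) (B : set (set R)) : Prop :=
  B `<=` tau /\
  (forall U, tau U -> U = \bigcup_(b in [set b | B b /\ b `<=` U]) b).

Definition weight_eq (tau : set (set R)) (K : Type) : Prop :=
  (exists B, is_base tau B /\ (B #= [set: K])%card) /\
  (forall B, is_base tau B -> ([set: K] #<= B)%card).

Definition homeomorphic (tau tau' : set (set R)) : Prop :=
  exists f g : R -> R,
    [/\ cancel f g, cancel g f,
        (forall U, tau' U -> tau (f @^-1` U)) &
        (forall U, tau U -> tau' (g @^-1` U))].

(* Main.v *)
Require Import Defs.
From Stdlib Require Import Reals.
From HB Require Import structures.
From mathcomp Require Import all_boot all_order all_algebra.
From mathcomp Require Import all_classical all_reals all_analysis.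
From mathcomp Require Import Rstruct Rstruct_topology.
From mathcomp Require Import zify ring lra.
Import Order.TTheory GRing.Theory Num.Theory.
Import numFieldNormedType.Exports.
Local Open Scope classical_set_scope.

(** Colour the natural numbers with every colour [k : nat] used infinitely
    often, and let [A i], [i : K], be sets of naturals that are independent
    within each colour class.  For [S : set K] weaken the Euclidean topology at
    each natural number [k] only: a neighbourhood of [k] must also contain
    intervals of some fixed radius around [n + 1/2] for all large [n] of colour
    [k] with [A i n <-> S i] for all [i] in some finite set.  Every point still
    has small "closed" neighbourhoods, so the space is regular, hence completely
    normal because it is hereditarily Lindelof; it is Baire because it is
    Euclidean off the naturals; its weight is that of the filter of the
    [n + 1/2] attached to a natural, which is the cardinality of [K] by
    independence.  A homeomorphism between two such spaces is automatically a
    Euclidean homeomorphism, because the pieces of a small neighbourhood of [k]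
    around the points [n + 1/2] are clopen in it, so no Euclidean interval
    through [k] can reach them.  It is therefore monotone, and it permutes the
    naturals, the points at which the topology is not Euclidean; so it fixes
    each of them and maps each [[n, n + 1]] to itself, whence both filters, and
    both [S], agree. *)

(** * Cardinal arithmetic from Zorn's lemma *)

(** Zorn's lemma gives a maximal partial bijection between [A] and [B]; if it missed a point on each
    side, that pair could be added. *)
Lemma injection_total {T U : Type} (t0 : T) (u0 : U) (A : set T) (B : set U) :
  (exists f : T -> U, set_fun A B f /\ forall x y, A x -> A y -> f x = f y -> x = y) \/
  (exists g : U -> T, set_fun B A g /\ forall x y, B x -> B y -> g x = g y -> x = y).
Proof.
pose P (G : set (T * U)) := (forall p, G p -> A p.1 /\ B p.2) /\
  (forall p q, G p -> G q -> (p.1 = q.1 <-> p.2 = q.2)).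
have [F FP totF|G [[GAB Ginj] Gmax]] := @Zorn_bigcup _ P.
  split=> [p [X FX Xp]|p q [X FX Xp] [Y FY Yq]]; first exact: (FP _ FX).1.
  have [XY|YX] := totF _ _ FX FY.
    exact: (FP _ FY).2 (XY _ Xp) Yq.
  exact: (FP _ FX).2 Xp (YX _ Yq).
have [/choice[f fG]|/existsNP[a /forallNP Na]] :=
    pselect (forall x, exists y, A x -> G (x, y)).
  left; exists f; split=> [x Ax|x y Ax Ay fxy]; first exact: (GAB _ (fG _ Ax)).2.
  exact/(Ginj _ _ (fG _ Ax) (fG _ Ay)).
have [/choice[g gG]|/existsNP[b /forallNP Nb]] :=
    pselect (forall y, exists x, B y -> G (x, y)).
  right; exists g; split=> [x Bx|x y Bx By gxy]; first exact: (GAB _ (gG _ Bx)).1.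
  exact/(Ginj _ _ (gG _ Bx) (gG _ By)).
exfalso.
have /not_implyP[Aa _] := Na u0; have /not_implyP[Bb _] := Nb t0.
have {}Na y : ~ G (a, y) by move=> Gay; exact: (Na y).
have {}Nb x : ~ G (x, b) by move=> Gxb; exact: (Nb x).
apply: (Gmax (G `|` [set (a, b)])).
  split=> [p|GsubG]; first by left.
  by apply: (Na b); apply: GsubG; right.
split=> [p [/GAB//|->//]|[x y] [x' y'] /= [Gp|[-> ->]] [Gq|[-> ->]]].
- exact: Ginj Gp Gq.
- by split=> E; exfalso; [apply: (Na y)|apply: (Nb x)]; rewrite -E.
- by split=> E; exfalso; [apply: (Na y')|apply: (Nb x')]; rewrite E.
- by [].
Qed.

Lemma injection_square {T : Type} (i : nat -> T) : injective i ->
  exists f : T * T -> T, injective f.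
Proof.
move=> inji.
(* [P G]: [G] is the graph of an injection of [dom G * dom G] into [dom G].  For
   a maximal [G], either the complement of [dom G] embeds into [dom G], and the
   injection transports to [T], or a disjoint copy of [dom G] can be added. *)
pose dom (G : set (T * T * T)) x := exists z, G (x, x, z).
have dom_sub G H x : G `<=` H -> dom G x -> dom H x.
  by move=> GH [z /GH Hz]; exists z.
pose P G := [/\ (forall a b c, G (a, b, c) -> [/\ dom G a, dom G b & dom G c]),
  (forall a b, dom G a -> dom G b -> exists c, G (a, b, c)),
  (forall a b c a' b' c', G (a, b, c) -> G (a', b', c') ->
     (a, b) = (a', b') <-> c = c') &
  (* Guarded by nonemptiness because the empty chain has empty union. *)
  G !=set0 -> forall k, dom G (i k)].
have [F FP totF|G [[Gdom Gtot Ginj Gi] Gmax]] := @Zorn_bigcup _ P.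
  have FS X : F X -> X `<=` \bigcup_(X in F) X by move=> FX p Xp; exists X.
  split=> [a b c [X FX Xp]|a b [u [X FX Xp]] [v [Y FY Yq]]|
           a b c a' b' c' [X FX Xp] [Y FY Yq]|[p [X FX Xp]] k].
  - by have [XP _ _ _] := FP _ FX; have [? ? ?] := XP _ _ _ Xp;
      split; apply: dom_sub (FS _ FX) _.
  - have [XY|YX] := totF _ _ FX FY.
      have [_ YP _ _] := FP _ FY; have [||c Yc] := YP a b; last by exists c, Y.
      + by exists u; apply: XY.
      + by exists v.
    have [_ XP _ _] := FP _ FX; have [||c Xc] := XP a b; last by exists c, X.
    + by exists u.
    + by exists v; apply: YX.
  - have [XY|YX] := totF _ _ FX FY.
      by have [_ _ + _] := FP _ FY; apply=> //; exact: XY.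
    by have [_ _ + _] := FP _ FX; apply=> //; exact: YX.
  - have [_ _ _ XP] := FP _ FX; apply: dom_sub (FS _ FX) _.
    by apply: XP; exists p.
have Gne : G !=set0.
  apply/set0P/eqP => G0.
  pose G1 := [set p | exists m n : nat, p = (i m, i n, i (pickle (m, n)))].
  have domG1 k : dom G1 (i k) by exists (i (pickle (k, k))), k, k.
  apply: (Gmax G1).
    split=> [p|]; first by rewrite G0.
    by move=> /(_ (i 0, i 0, i (pickle (0, 0)))%N); rewrite G0; apply; exists 0%N, 0%N.
  split=> [a b c [m [n [-> -> ->]]]|a b [? [m [n [-> _ _]]]] [? [m' [n' [-> _ _]]]]|
      a b c a' b' c' [m [n [-> -> ->]]] [m' [n' [-> -> ->]]]|_] //.
  - by exists (i (pickle (m, m'))), m, m'.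
  - split=> [[/inji-> /inji->//]|/inji/(pcan_inj pickleK)[-> ->]//].
have {}Gi := Gi Gne.
pose D := dom G.
have /choice[f fG] (p : T * T) : exists c, D p.1 -> D p.2 -> G (p.1, p.2, c).
  have [[D1 D2]|ND] := pselect (D p.1 /\ D p.2).
    by have [c] := Gtot _ _ D1 D2; exists c.
  by exists p.1 => D1 D2; exfalso; apply: ND.
have fD p : D p.1 -> D p.2 -> D (f p).
  by move=> D1 D2; have [] := Gdom _ _ _ (fG _ D1 D2).
have f_inj a b a' b' : D a -> D b -> D a' -> D b' -> f (a, b) = f (a', b') ->
    a = a' /\ b = b'.
  move=> Da Db Da' Db' /(Ginj _ _ _ _ _ _ (fG (a, b) Da Db) (fG (a', b') Da' Db')).
  by case.
have [[g [gD g_inj]]|[g [gD g_inj]]] := injection_total (i 0%N) (i 0%N) (~` D) D.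
  (* [F] embeds [T] into [D]; the second coordinate, [i 0] or [i 1], records whether the point was
     in [D]. *)
  pose F x := if pselect (D x) then f (x, i 0%N) else f (g x, i 1%N).
  have FD x : D (F x).
    by rewrite /F; case: pselect => Dx; apply: fD => //=; [exact: Gi|exact: gD|exact: Gi].
  have F_inj : injective F.
    move=> x y; rewrite /F.
    case: pselect => Dx; case: pselect => Dy /f_inj[] //; do ?[exact: Gi|exact: gD].
    + by move=> _ /inji.
    + by move=> _ /inji.
    + by move=> gxy _; apply: g_inj gxy.
  exists (fun p => f (F p.1, F p.2)) => -[a b] [a' b'] /f_inj[] //=.
  by move=> /F_inj-> /F_inj->.
exfalso.
(* Tag [false] marks a point of [D], tag [true] its copy under [g] outside [D]. Pairs tagged [false]
   twice keep their value, so [G'] extends [G]; the other three tag patterns are numbered 1, 2, 3 by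
   [p.1 + q.1.*2] and sent into the copy. *)
pose u (p : bool * T) := if p.1 then g p.2 else p.2.
pose v (p q : bool * T) := if p.1 || q.1 then
  g (f (i (p.1 + q.1.*2)%N, f (p.2, q.2))) else f (p.2, q.2).
have u_inj p q : D p.2 -> D q.2 -> u p = u q -> p = q.
  case: p q => [[] x] [[] y] Dx Dy; rewrite /u /= => E.
  - by rewrite (g_inj x y).
  - by have := gD _ Dx; rewrite E.
  - by have := gD _ Dy; rewrite -E.
  - by rewrite E.
have f2D n p : D p.1 -> D p.2 -> D (f (i n, f p)).
  by move=> ? ?; apply: (fD) => //=; [exact: Gi|exact: fD].
pose G' := [set r | exists p q, [/\ D p.2, D q.2 & r = (u p, u q, v p q)]].
have domu p : D p.2 -> dom G' (u p) by move=> Dp; exists (v p p), p, p.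
apply: (Gmax G').
  split=> [[[a b] c] Gp|].
    have [Da Db _] := Gdom _ _ _ Gp.
    exists (false, a), (false, b); split=> //; rewrite /u /v /=; congr (_, _, _).
    exact/(Ginj _ _ _ _ _ _ Gp (fG (a, b) Da Db)).
  move=> G'G; have D0 := Gi 0%N.
  by apply: (gD _ D0); apply: dom_sub G'G _; apply: (domu (true, i 0%N)).
split=> [a b c [p [q [Dp Dq [-> -> ->]]]]|a b [? [p [_ [Dp _ [-> _ _]]]]]
    [? [q [_ [Dq _ [-> _ _]]]]]|a b c a' b' c' [p [q [Dp Dq [-> -> ->]]]]
    [p' [q' [Dp' Dq' [-> -> ->]]]]|_ k].
- split; [exact: domu|exact: domu|].
  by rewrite /v; case: ifP => _; [apply: (domu (true, _))|apply: (domu (false, _))];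
    rewrite /=; [exact: f2D|exact: fD].
- by exists (v p q), p, q.
- split=> [[/u_inj-> // /u_inj-> //]|].
  have ff n m x y x' y' : D x -> D y -> D x' -> D y' ->
      f (i n, f (x, y)) = f (i m, f (x', y')) -> [/\ n = m, x = x' & y = y'].
    move=> Dx Dy Dx' Dy' /f_inj /= []; do ?[exact: Gi|exact: fD].
    by move=> /inji-> /f_inj[].
  case: p q p' q' Dp Dq Dp' Dq' => [s x] [t y] [s' x'] [t' y'] /= Dx Dy Dx' Dy'.
  rewrite /v /=; case: ifP => st; case: ifP => st'.
  + move=> /(g_inj _ _ (f2D _ (_, _) Dx Dy) (f2D _ (_, _) Dx' Dy')) /ff[] // + -> ->.
    by move: s t s' t' {st st'} => [] [] [] [].
  + by move=> E; case: (gD _ (f2D (s + t.*2)%N (x, y) Dx Dy)); rewrite E; exact: fD.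
  + by move=> E; case: (gD _ (f2D (s' + t'.*2)%N (x', y') Dx' Dy')); rewrite -E; exact: fD.
  + move=> /f_inj[] // -> ->.
    by move: s t s' t' st st' => [] [] [] [].
- exact: (domu (false, i k) (Gi k)).
Qed.

(** Folding [f] over a list can be undone once the length is known, so the length is paired with the
    fold. *)
Lemma injection_seq {T : Type} (i : nat -> T) : injective i ->
  exists f : seq T -> T, injective f.
Proof.
move=> inji; have [f f_inj] := injection_square _ inji.
pose fold := foldr (fun x a => f (x, a)) (i 0%N).
exists (fun s => f (i (size s), fold s)) => s t /f_inj[/inji].
elim: s t => [|x s IHs] [|y t] //= [st] /f_inj[-> /(IHs _ st) -> //].
Qed.
Lemma card_le_injection {T U : Type} {A : set T} {B : set U} (f : T -> U) :
  set_fun A B f -> set_inj A f -> (A #<= B)%card.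
Proof.
move=> fAB finj; have /injfunPex[g] : exists2 f : T -> U, set_fun A B f & set_inj A f.
  by exists f.
exact: inj_card_le g.
Qed.

Lemma infinite_injection {T : Type} : infinite_set [set: T] ->
  exists f : nat -> T, injective f.
Proof.
move=> /infiniteP/card_leP[g].
exists (fun n => set_val (g (SigSub (mem_set (I : [set: nat] n))))) => m n.
move=> /val_inj /(@inj _ _ _ g) E.
have := E (mem_set I) (mem_set I).
by case.
Qed.

(** * Coloured independent families of sets of naturals *)

Local Open Scope ring_scope.

(** A natural codes a colour, a counter and a finite list of rational intervals; it belongs to [A i]
    when some interval of its list contains [e i]. Finitely many distinct reals are isolated from
    each other by rational intervals, so every pattern on [s] is realised. *)
Lemma independent_family {K : eqType} {e : K -> R} : injective e ->
  exists (c : nat -> nat) (A : K -> nat -> Prop), forall k (s : seq K) (S : set K) (m : nat),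
    exists n : nat, [/\ (m <= n)%N, c n = k & forall i, i \in s -> A i n <-> S i].
Proof.
move=> inje.
pose dec n : nat * nat * seq (rat * rat) := odflt (0%N, 0%N, [::]) (unpickle n).
pose meets (T : seq (rat * rat)) (r : R) :=
  exists2 ab, ab \in T & ratr ab.1 < r < ratr ab.2.
exists (fun n => (dec n).1.1), (fun i n => meets (dec n).2 (e i)) => k s S m.
suff [T TP] : exists T, forall i, i \in s -> meets T (e i) <-> S i.
  have decK (j : nat) : dec (pickle (k, j, T)) = (k, j, T) by rewrite /dec pickleK.
  (* The counter [j] gives infinitely many codes of the same colour and list, hence one beyond
     [m]. *)
  have inj_code : injective (fun j : nat => pickle (k, j, T)).
    by move=> j j' E; have := congr1 dec E; rewrite !decK => -[].
  have [j mj] := injective_gtn inj_code m.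
  move: (pickle _) (decK j) mj => n dn mn.
  by exists n; rewrite dn; split; [exact: ltnW|..].
have /choice[ab abP] (i : K) : exists ab : rat * rat, ratr ab.1 < e i < ratr ab.2 /\
    forall j, j \in s -> ratr ab.1 < e j < ratr ab.2 -> j = i.
  have [d d0 ds] : exists2 d, 0 < d & forall j, j \in s -> j != i -> d <= `|e i - e j|.
    elim: s => [|j s [d d0 ds]]; first by exists 1.
    have [->|ji] := eqVneq j i.
      by exists d => // j'; rewrite inE => /predU1P[->|/ds//]; rewrite eqxx.
    exists (Num.min d `|e i - e j|).
      rewrite lt_min d0 normr_gt0 subr_eq0; apply: contra ji => /eqP ij.
      by apply/eqP/inje.
    move=> j'; rewrite inE ge_min => /predU1P[->|/ds + H]; first by rewrite lexx orbT.
    by move=> ->.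
  have [a] : exists a, ratr a \in `]e i - d, e i[ by apply: rat_in_itvoo; lra.
  have [b] : exists b, ratr b \in `]e i, e i + d[ by apply: rat_in_itvoo; lra.
  rewrite !in_itv /= => /andP[ib bd] /andP[da ai].
  exists (a, b); rewrite /= ai ib; split=> // j js /andP[aj jb].
  apply/eqP/negP => /negP /(ds _ js); rewrite leNgt ltr_norml => /negP; apply.
  by apply/andP; split; lra.
exists [seq ab i | i <- s & `[< S i >]] => i is_; split.
  move=> [_ /mapP[j + ->]]; rewrite mem_filter => /andP[/asboolP Sj js].
  by move=> /((abP j).2 _ is_) ->.
move=> Si; exists (ab i); last exact: (abP i).1.
by apply: map_f; rewrite mem_filter is_ andbT; apply/asboolP.
Qed.

(** * Estimates around naturals and half-integers *)

Lemma natr_dist (m n : nat) : `|m%:R - n%:R| < 1 :> R -> m = n.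
Proof.
rewrite ltr_norml => /andP[mn nm].
have mn1 : m%:R < n.+1%:R :> R by rewrite -[n.+1]addn1 natrD; lra.
have nm1 : n%:R < m.+1%:R :> R by rewrite -[m.+1]addn1 natrD; lra.
by move: mn1 nm1; rewrite !ltr_nat !ltnS => mn1 nm1; apply/eqP; rewrite eqn_leq mn1.
Qed.

Lemma nat_half_dist (m n : nat) : 1/2 <= `|m%:R - (n%:R + 1/2)| :> R.
Proof.
rewrite leNgt; apply/negP; rewrite ltr_norml => /andP[mn nm].
have : m = n by apply: natr_dist; rewrite ltr_norml; apply/andP; split; lra.
by move=> E; move: mn; rewrite E; lra.
Qed.

Lemma nat_above (x : R) : exists m : nat, x < m%:R.
Proof.
exists (Num.bound `|x|); apply: le_lt_trans (ler_norm x) _.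
exact: archi_boundP.
Qed.

Definition tol (m : nat) : R := m.+1%:R^-1.

Lemma tol_gt0 m : 0 < tol m.
Proof. by rewrite invr_gt0 ltr0n. Qed.

Lemma tol_lt (m n : nat) : (m < n)%N -> tol n < tol m.
Proof. by move=> mn; rewrite /tol ltf_pV2 ?posrE ?ltr0n // ltr_nat. Qed.

Lemma tol_le (m n : nat) : (m <= n)%N -> tol n <= tol m.
Proof. by rewrite leq_eqVlt => /predU1P[->//|/tol_lt/ltW]. Qed.

Lemma tol_le1 m : tol m <= 1.
Proof. by rewrite -[leRHS](@invr1 R); exact: (@tol_le 0%N). Qed.

Lemma tol3 (m : nat) : (2 <= m)%N -> tol m <= 1/3.
Proof. by rewrite mul1r; exact: (@tol_le 2%N). Qed.

Lemma tol_small (e : R) : 0 < e -> exists m : nat, forall n : nat, (m <= n)%N -> tol n < e.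
Proof.
move=> e0; have [m em] := nat_above e^-1; exists m => n mn.
rewrite invf_plt ?posrE ?ltr0n //; apply: lt_le_trans em _.
by rewrite ler_nat (leq_trans mn).
Qed.

Lemma lt_min_pos (d e : R) : 0 < d -> 0 < e -> exists r : R, [/\ 0 < r, r < d & r < e].
Proof.
move=> d0 e0; have m0 : 0 < Num.min d e by rewrite lt_min d0.
have md : Num.min d e <= d by rewrite ge_min lexx.
have me : Num.min d e <= e by rewrite ge_min lexx orbT.
by exists (Num.min d e / 2); split; lra.
Qed.

Lemma not_nat_dist (x : R) : (forall k : nat, x <> k%:R) ->
  exists2 e : R, 0 < e & forall k : nat, e <= `|x - k%:R|.
Proof.
move=> xN; have [x0|x0] := ltP x 0.
  exists (- x); first lra.
  move=> k; have k0 : 0 <= k%:R :> R by rewrite ler0n.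
  by rewrite ler0_norm; lra.
have /andP[nx xn] : (Num.truncn x)%:R <= x < (Num.truncn x).+1%:R by exact: truncn_itv.
set n := Num.truncn x in nx xn.
have xn0 := xN n; exists (Num.min (x - n%:R) (n.+1%:R - x)).
  rewrite lt_min; apply/andP; split; last lra.
  by rewrite subr_gt0 lt_neqAle nx andbT; apply/eqP => /esym.
move=> k; rewrite ge_min; apply/orP.
have [kn|nk] := leqP k n; [left|right].
  by have kn' : k%:R <= n%:R :> R; [rewrite ler_nat|rewrite ger0_norm; lra].
by have nk' : n.+1%:R <= k%:R :> R; [rewrite ler_nat|rewrite ler0_norm; lra].
Qed.

(** * Euclidean open sets, and regular topologies coarser than the Euclidean one *)

Lemma openR (U : set R) :
  open U <-> forall x, U x -> exists2 e : R, 0 < e & forall y, `|y - x| < e -> U y.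
Proof.
rewrite openE; split=> UP x /UP.
  move=> /nbhs_ballP[e /= e0 eU]; exists e => // y xy; apply: eU.
  by rewrite /ball /= distrC.
by move=> [e e0 eU]; apply/nbhs_ballP; exists e => //= y; rewrite /ball /= distrC; exact: eU.
Qed.

Definition thicken (E : set R) (d : R) : set R :=
  [set x | exists2 y, E y & `|x - y| < d].

(** The points whose distance to [E] exceeds [d]; the slack [r], uniform in [y], replaces an infimum
    and makes the set open. *)
Definition beyond (E : set R) (d : R) : set R :=
  [set x | exists2 r, 0 < r & forall y, E y -> d + r <= `|x - y|].

Lemma open_thicken E d : open (thicken E d).
Proof.
apply/openR => x [y Ey xy]; exists (d - `|x - y|); first lra.
by move=> z zx; exists y => //; have := ler_distD x z y; lra.
Qed.

Lemma open_beyond E d : open (beyond E d).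
Proof.
apply/openR => x [r r0 rE]; exists (r / 2); first lra.
move=> z zx; exists (r / 2); first lra.
by move=> y Ey; have := rE _ Ey; have := ler_distD z x y; rewrite (distrC x z); lra.
Qed.

Lemma thicken_beyond E d : thicken E d `&` beyond E d = set0.
Proof. by apply/seteqP; split=> // x [[y Ey xy] [r r0 /(_ y Ey)]]; lra. Qed.

Definition regular_top (tau : set (set R)) : Prop :=
  forall U x, tau U -> U x -> exists V W,
    [/\ tau V, tau W, V x, V `&` W = set0 & ~` U `<=` W].

Lemma regular_hausdorff {tau} : (forall x, tau (~` [set x])) -> regular_top tau ->
  hausdorff_top tau.
Proof.
move=> tau1 treg x y xy; have [|V [W [tV tW Vx VW yW]]] := treg _ x (tau1 y); first exact.
by exists V, W; split=> //; apply: yW; rewrite setCK.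
Qed.

Lemma rat_itv_nbhs (U : set R) x : open U -> U x -> exists ab : rat * rat,
  ratr ab.1 < x < ratr ab.2 /\ forall y, ratr ab.1 < y < ratr ab.2 -> U y.
Proof.
move=> /openR oU /oU[e e0 eU].
have [a] : exists a, ratr a \in `]x - e, x[ by apply: rat_in_itvoo; lra.
have [b] : exists b, ratr b \in `]x, x + e[ by apply: rat_in_itvoo; lra.
rewrite !in_itv /= => /andP[xb be] /andP[ea ax].
exists (a, b); rewrite /= ax xb; split=> // y /andP[ay yb].
by apply: eU; rewrite ltr_norml; apply/andP; split; lra.
Qed.

(* The classical argument that a regular Lindelof space is normal, applied to
   subspaces; a topology coarser than the Euclidean one is hereditarily
   Lindelof through the rational intervals. *)
Lemma regular_completely_normal {tau} : is_topology tau -> tau `<=` eta_top ->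
  regular_top tau -> completely_normal tau.
Proof.
move=> [t0 tT tI tU] teta treg Y A B [F [cF AE]] [G [cG BE]] AB.
pose itv n : set R := [set x | if unpickle n is Some ab
  then ratr (ab : rat * rat).1 < x < ratr ab.2 else false].
pose separates (C : set R) n V W := [/\ tau V, tau W, V `&` W = set0, C `<=` W & itv n `<=` V].
have family C : exists V W : nat -> set R, [/\ forall n, tau (V n), forall n, tau (W n),
    forall n, V n `&` W n = set0, forall n, C `<=` W n &
    forall n, (exists V' W', separates C n V' W') -> itv n `<=` V n].
  have /choice[VW VWP] n : exists VW : set R * set R,
      [/\ tau VW.1, tau VW.2, VW.1 `&` VW.2 = set0, C `<=` VW.2 &
          (exists V' W', separates C n V' W') -> itv n `<=` VW.1].
    have [[V [W [tV tW VW CW nV]]]|none] := pselect (exists V W, separates C n V W).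
      by exists (V, W); split.
    (* Intervals that cannot be separated from [C] get a harmless pair, so the families are indexed
       by all of [nat]. *)
    by exists (set0, setT); split=> //=; rewrite set0I.
  by exists (fun n => (VW n).1), (fun n => (VW n).2); split=> n; have [] := VWP n.
have cover C D V : tau (~` C) -> D `&` C = set0 -> (forall n, (exists V' W',
    separates (Y `&` C) n V' W') -> itv n `<=` V n) -> D `<=` \bigcup_n V n.
  move=> tC DC VP a Da.
  have [|V1 [W1 [tV1 tW1 V1a VW1 CW1]]] := treg _ a tC.
    by move=> Ca; have : (D `&` C) a by []; rewrite DC.
  have [ab [aab abV]] := rat_itv_nbhs _ _ (teta _ tV1) V1a.
  have [n abE] : exists n, itv n = [set x | ratr ab.1 < x < ratr ab.2].
    by exists (pickle ab); rewrite /itv pickleK.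
  exists n => //; apply: (VP _ _ a); last by rewrite abE.
  exists V1, W1; split=> //; first by move=> x [_ Cx]; apply: CW1; rewrite setCK.
  by move=> x; rewrite abE; exact: abV.
have [VA [WA [tVA tWA VWA BWA nVA]]] := family B.
have [VB [WB [tVB tWB VWB AWB nVB]]] := family A.
(* In place of removing the closures of the first [n] sets of the opposite family, [V n] is
   intersected with the open sets disjoint from them. *)
have cutP V W : (forall n, tau (V n)) -> (forall n, tau (W n)) ->
    tau (\bigcup_n (V n `&` [set x : R | forall m : nat, (m <= n)%N -> W m x])).
  move=> tV tW; apply: tU => n; apply: (tI) => //; elim: n => [|n IHn].
    rewrite (_ : mkset _ = W 0%N) //; apply/seteqP; split=> x Wx; first exact: Wx.
    by move=> m; rewrite leqn0 => /eqP->.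
  rewrite (_ : mkset _ = [set x : R | forall m : nat, (m <= n)%N -> W m x] `&` W n.+1).
    exact: tI.
  apply/seteqP; split=> [x Wx|x [Wx WSx] m].
    by split; [move=> m mn; apply: Wx; exact: leqW|exact: Wx].
  by rewrite leq_eqVlt => /predU1P[->|/Wx].
exists (\bigcup_n (VA n `&` [set x : R | forall m : nat, (m <= n)%N -> WB m x])),
  (\bigcup_n (VB n `&` [set x : R | forall m : nat, (m <= n)%N -> WA m x])); split.
- exact: cutP.
- exact: cutP.
- move=> a Aa; have [||n _ Vna] := cover G A VA cG _ _ a Aa.
  + by apply/seteqP; split=> // x [Ax Gx]; rewrite -AB; split=> //;
      move: Ax; rewrite AE BE => -[].
  + by move=> n; rewrite -BE; exact: nVA.
  + by exists n => //; split=> // m _; exact: AWB.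
- move=> a Ba; have [||n _ Vna] := cover F B VB cF _ _ a Ba.
  + by apply/seteqP; split=> // x [Bx Fx]; rewrite -AB; split=> //;
      move: Bx; rewrite AE BE => -[].
  + by move=> n; rewrite -AE; exact: nVB.
  + by exists n => //; split=> // m _; exact: BWA.
- apply/seteqP; split=> // x [[_ [n _ [VAx WBx]]] [n' _ [VBx WAx]]].
  have [nn'|n'n] := leqP n n'.
    by rewrite -(VWA n); split=> //; exact: WAx.
  by rewrite -(VWB n'); split=> //; apply: WBx; exact: ltnW.
Qed.

(** * The weakened topologies: neighbourhoods, regularity, complete normality *)

Section CoarseTopology.
Context {K : eqType} (c : nat -> nat) (A : K -> nat -> Prop)
  (independent : forall k (s : seq K) (S : set K) (m : nat), exists n : nat,
     [/\ (m <= n)%N, c n = k & forall i, i \in s -> A i n <-> S i]).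

(** For fixed [S] and [k] these sets form a base of the filter along which the points [n + 1/2]
    converge to [k]. *)
Definition tail (S : set K) (k : nat) (s : seq K) (m : nat) : set nat :=
  [set n | [/\ (m <= n)%N, c n = k & forall i, i \in s -> A i n <-> S i]].

Definition halves (N : set nat) : set R := [set n%:R + 1/2 | n in N].

Definition coarse (S : set K) : set (set R) :=
  [set U : set R | open U /\ forall k : nat, U k%:R ->
     exists s m, thicken (halves (tail S k s m)) (tol m) `<=` U].

Definition core S k s m : set R := [set k%:R] `|` halves (tail S k s m).

(** The index [m] sets both the cut-off and the radius, so one parameter shrinks both. *)
Definition basic S k s m : set R := thicken (core S k s m) (tol m).

Lemma thickenS E F d e : E `<=` F -> d <= e -> thicken E d `<=` thicken F e.
Proof.
by move=> EF de x [y Ey xy]; exists y; [exact: EF|exact: lt_le_trans de].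
Qed.

Lemma subset_tail S k s s' (m m' : nat) : {subset s <= s'} -> (m <= m')%N ->
  tail S k s' m' `<=` tail S k s m.
Proof.
move=> ss' mm' n [m'n cn AS]; split=> //; first exact: leq_trans m'n.
by move=> i /ss'; exact: AS.
Qed.

Lemma thicken_tailS S k s s' (m m' : nat) : {subset s <= s'} -> (m <= m')%N ->
  thicken (halves (tail S k s' m')) (tol m') `<=`
  thicken (halves (tail S k s m)) (tol m).
Proof.
move=> ss' mm'; apply: thickenS; last exact: tol_le.
by move=> _ [n tn <-]; exists n => //; exact: subset_tail tn.
Qed.

Lemma coarse_topology S : is_topology (coarse S).
Proof.
split.
- by split; [exact: open0|].
- by split; [exact: openT|move=> k _; exists [::], 0%N].
- move=> U V [oU UP] [oV VP]; split; first exact: openI.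
  move=> k [/UP[s [m sU]] /VP[s' [m' sV]]]; exists (s ++ s'), (maxn m m').
  apply: subset_trans (_ : _ `<=` thicken (halves (tail S k s m)) (tol m) `&`
    thicken (halves (tail S k s' m')) (tol m')) (setISS sU sV) => x tx.
  split; apply: thicken_tailS tx; rewrite ?leq_maxl ?leq_maxr //.
    by move=> i si; rewrite mem_cat si.
  by move=> i si; rewrite mem_cat si orbT.
- move=> I F FP; split; first by apply: bigcup_open => i _; exact: (FP i).1.
  move=> k [i _ /((FP i).2)[s [m sF]]]; exists s, m => x /sF Fx.
  by exists i.
Qed.

Lemma coarse_open S (U : set R) : coarse S U -> open U. Proof. by case. Qed.

Lemma coarse_nat_free S (U : set R) : open U -> (forall k : nat, ~ U k%:R) -> coarse S U.
Proof. by move=> oU UN; split=> // k /UN. Qed.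

(** Far enough out, all pieces around half-integers lie in the ray, whatever their colour. *)
Lemma coarse_cobounded S (U : set R) (b : R) : open U -> (forall x, b < x -> U x) -> coarse S U.
Proof.
move=> oU bU; split=> // k _; have [m bm] := nat_above b.
exists [::], m.+2 => x [_ [n [mn _ _] <-] xn]; apply: bU.
have mn' : m.+2%:R <= n%:R :> R by rewrite ler_nat.
have := tol_le1 m.+2.
rewrite -[m.+2]addn2 natrD in mn'; move: xn; rewrite ltr_norml => /andP[xn _] m1.
lra.
Qed.

Lemma half_far (d : R) (m k : nat) (N : set nat) : thicken (halves N) d k%:R -> 1/2 < d.
Proof. by move=> [_ [n _ <-]]; exact: le_lt_trans (nat_half_dist _ _). Qed.

(** A radius of at most 1/3 keeps out every natural but [k], since naturals are at least 1/2 away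
    from half-integers. Only the condition at [k] remains. *)
Lemma coarse_basic S k s m : (2 <= m)%N -> coarse S (basic S k s m).
Proof.
move=> m2; have m3 := tol3 _ m2; split; first exact: open_thicken.
move=> j [y [->|yt] jy].
  have -> : j = k by apply: natr_dist; lra.
  by exists s, m; apply: thickenS => // z tz; right.
have : 1/2 < tol m by apply: (half_far _ m j (tail S k s m)); exists y.
lra.
Qed.

Lemma basic_center S k s m : basic S k s m k%:R.
Proof. by exists k%:R; [left|rewrite subrr normr0 tol_gt0]. Qed.

Lemma basic_sub S (U : set R) (k : nat) : coarse S U -> U k%:R ->
  exists s m, (2 <= m)%N /\ basic S k s m `<=` U.
Proof.
move=> [/openR oU UP] Uk; have [s [m1 sU]] := UP _ Uk.
have [e e0 eU] := oU _ Uk; have [m2 m2e] := tol_small _ e0.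
exists s, (m1 + m2).+2%N; split=> // x [y [->|ty] xy].
  by apply: eU; apply: lt_trans xy _; apply: m2e; lia.
apply: sU; apply: thicken_tailS (_ : thicken _ _ x); last by exists y; first exact: ty.
  by [].
by lia.
Qed.

(** At a natural [k], a smaller radius and a later tail give a neighbourhood whose [beyond] set is
    open at the other naturals, because distinct colours use disjoint sets of half-integers.
    Elsewhere a short interval free of naturals suffices. *)
Lemma coarse_regular S : regular_top (coarse S).
Proof.
move=> U x cU Ux.
have [[k xk]|xN] := pselect (exists k : nat, x = k%:R).
  rewrite xk in Ux *; have [s [m [m2 mU]]] := basic_sub _ _ _ cU Ux.
  pose M := (2 * m).+2%N.
  have Mm : tol M < tol m by apply: tol_lt; lia.
  have m3 := tol3 _ m2.
  exists (basic S k s M), (beyond (core S k s M) (tol M)); split.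
  - exact: coarse_basic.
  - split; first exact: open_beyond.
    move=> j [r r0 jr]; have jk : j <> k.
      move=> jk; have /= := jr k%:R; rewrite jk subrr normr0.
      by have M0 := tol_gt0 M; move=> /(_ (or_introl erefl)); lra.
    (* From [k + 2] on, the pieces stay away from [k]. A half-integer of colour [j] is at least 1
       from those of colour [k], so two radii of at most 1/3 still leave the margin 1/6. *)
    exists [::], (k + 2)%N => z [_ [n [kn cn _] <-] zn].
    have k3 : tol (k + 2)%N <= 1/3 by apply: tol3; lia.
    exists (1/6); first lra.
    move=> y [->|[n' [_ cn' _] <-]].
      have kn' : (k + 2)%N%:R <= n%:R :> R by rewrite ler_nat.
      rewrite natrD in kn'; move: zn; rewrite ltr_norml => /andP[zn _].
      by rewrite ger0_norm; lra.
    have : ~ `|n%:R - n'%:R| < 1 :> R by move=> /natr_dist E; apply: jk; rewrite -cn -cn' E.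
    move=> /negP; rewrite -leNgt => nn'.
    have := ler_distD z (n%:R + 1/2) (n'%:R + 1/2); rewrite (distrC _ z).
    by rewrite (_ : n%:R + 1/2 - (n'%:R + 1/2) = n%:R - n'%:R :> R); [lra|ring].
  - exact: basic_center.
  - exact: thicken_beyond.
  - move=> z Uz; exists (tol m - tol M); first lra.
    move=> y cy; rewrite addrC subrK leNgt; apply/negP => zy; apply: Uz.
    apply: mU; exists y => //; case: cy => [->|[n tn <-]]; first by left.
    by right; exists n => //; apply: subset_tail tn => //; rewrite /M; lia.
have [|d d0 dN] := not_nat_dist x; first by move=> k xk; apply: xN; exists k.
have [e e0 eU] := (openR U).1 cU.1 _ Ux.
have [r [r0 rd re]] := lt_min_pos _ _ d0 e0.
exists (thicken [set x] r), (beyond [set x] r); split.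
- apply: coarse_nat_free; first exact: open_thicken.
  by move=> k [_ -> kx]; have := dN k; rewrite distrC; lra.
- apply: (@coarse_cobounded _ _ (x + 2 * r)%R); first exact: open_beyond.
  by move=> z xz; exists r => // _ ->; rewrite ger0_norm; lra.
- by exists x => //; rewrite subrr normr0.
- exact: thicken_beyond.
- move=> z Uz; exists (e - r); first lra.
  by move=> _ ->; rewrite addrC subrK leNgt; apply/negP => /eU.
Qed.

Lemma coarse_T1 S x : coarse S (~` [set x]).
Proof.
apply: (@coarse_cobounded _ _ x) => [|y xy yx]; last by rewrite yx ltxx in xy.
apply/openR => y yx; exists `|y - x|; first by rewrite normr_gt0 subr_eq0; apply/eqP.
by move=> z + zx; rewrite zx distrC ltxx.
Qed.

Lemma coarse_in_L S : in_L (coarse S).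
Proof.
split; [exact: coarse_topology| |exact: coarse_open].
by apply: regular_hausdorff; [exact: coarse_T1|exact: coarse_regular].
Qed.

Lemma coarse_completely_normal S : completely_normal (coarse S).
Proof.
apply: regular_completely_normal; [exact: coarse_topology|exact: coarse_open|].
exact: coarse_regular.
Qed.

(** * The Baire property *)

Lemma open_nat_free : open [set x : R | forall k : nat, x <> k%:R].
Proof.
apply/openR => x /not_nat_dist[e e0 eN]; exists e => // y yx k yk.
by have := eN k; rewrite -yk distrC leNgt yx.
Qed.

(** A nonempty Euclidean open set stays nonempty without the naturals and is then open in
    [coarse S]. Dense open sets are therefore Euclidean dense, and the Baire theorem for the real
    line applies. *)
Lemma coarse_baire S : baire (coarse S).
Proof.
move=> U UP V cV V0.
have : dense (\bigcap_n U n); last by apply; [|exact: coarse_open cV].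
refine (@Baire R R^o U _) => n; have [cU dU] := UP n; split; first exact: coarse_open cU.
move=> O [x Ox] oO; have [e e0 eO] := (openR O).1 oO _ Ox.
pose O' := O `&` [set x : R | forall k : nat, x <> k%:R].
have [||z [[Oz _] Uz]] := dU O'; last by exists z.
  apply: coarse_nat_free; first by apply: openI => //; exact: open_nat_free.
  by move=> k [_ /(_ k)].
have [[k xk]|xN] := pselect (exists k : nat, x = k%:R); last first.
  by exists x; split=> // k xk; apply: xN; exists k.
(* Moving off a natural by less than 1 reaches a point that is not a natural. *)
have [t [t0 te t1]] := lt_min_pos _ _ e0 ltr01.
exists (x + t); split.
  by apply: eO; rewrite addrC addKr gtr0_norm.
move=> j xj; have kj : j = k.
  by apply: natr_dist; rewrite -xj xk addrC addKr gtr0_norm.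
by move: xj; rewrite xk kj; lra.
Qed.

(** * The weight *)

(** Any single point of the cell []n, n + 1[] in a basic set reveals that [n] is in the tail;
    [k < n] rules out the interval around [k] itself. *)
Lemma basic_tail S k s (m n : nat) (x : R) : (2 <= m)%N -> (k < n)%N ->
  n%:R < x < n.+1%:R -> basic S k s m x -> tail S k s m n.
Proof.
move=> /tol3 m3 kn /andP[nx xn] [y [->|[n' tn' <-]]].
  have : k.+1%:R <= n%:R :> R by rewrite ler_nat.
  rewrite -[k.+1]addn1 natrD => kn'.
  by rewrite ger0_norm; lra.
rewrite ltr_norml => /andP[? ?]; rewrite -[n.+1]addn1 natrD in xn.
suff -> : n = n' by [].
by apply: natr_dist; rewrite ltr_norml; apply/andP; split; lra.
Qed.

Lemma half_itv (n : nat) (x : R) : x = (n%:R + 1/2)%R -> n%:R < x < n.+1%:R.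
Proof. by move=> ->; rewrite -[n.+1]addn1 natrD; apply/andP; split; lra. Qed.

Lemma half_thicken S k s (m n : nat) : tail S k s m n ->
  thicken (halves (tail S k s m)) (tol m) (n%:R + 1/2).
Proof.
by move=> tn; exists (n%:R + 1/2); [exists n|rewrite subrr normr0 tol_gt0].
Qed.

(** A base element [b i] squeezed between 0 and [basic S 0 [:: i] 2] contains the pieces of some
    tail with finite list [s (b i)]. By independence such a tail cannot control [A i] unless [i] is
    in the list. *)
Lemma base_finite_to_one S B : is_base (coarse S) B ->
  exists (b : K -> set R) (s : set R -> seq K), forall i, B (b i) /\ i \in s (b i).
Proof.
move=> [Bcoarse Bbase].
have /choice[b bP] i : exists b, [/\ B b, b 0%:R & b `<=` basic S 0 [:: i] 2].
  have c2 : coarse S (basic S 0 [:: i] 2) by exact: coarse_basic.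
  have : basic S 0 [:: i] 2 0%:R by exact: basic_center.
  by rewrite (Bbase _ c2) => -[b [Bb bsub] b0]; exists b; rewrite -Bbase.
have /choice[s sP] (b' : set R) : exists s, B b' -> b' 0%:R ->
    exists m, thicken (halves (tail S 0 s m)) (tol m) `<=` b'.
  have [[Bb b0]|nb] := pselect (B b' /\ b' 0%:R).
    by have [s sP] := (Bcoarse _ Bb).2 _ b0; exists s.
  by exists [::] => Bb b0; case: nb.
exists b, s => i; have [Bb b0 bsub] := bP i; split=> //.
have [m mP] := sP _ Bb b0; apply/negPn/negP => isb.
(* [flip] differs from [S] exactly at [i]. The bound [maxn m 1] below makes [n] positive, as
   [basic_tail] requires for [k = 0]. *)
pose flip : set K := [set j | if j == i then ~ S i else S j].
have [n [mn cn Aflip]] := independent 0 (i :: s (b i)) flip (maxn m 1).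
have tn : tail S 0 (s (b i)) m n.
  split=> [|//|j js]; first by rewrite (leq_trans _ mn) // leq_maxl.
  rewrite (Aflip j) ?inE ?js ?orbT // /flip /=.
  by case: eqP js isb => // -> ->.
have n0 : (0 < n)%N by rewrite (leq_trans _ mn) // leq_maxr.
have [//|_ _ /(_ i)] := basic_tail _ _ _ _ _ _ _ n0 (half_itv n _ erefl)
  (bsub _ (mP _ (half_thicken _ _ _ _ _ tn))).
rewrite inE eqxx => /(_ isT) AS.
have := Aflip i; rewrite inE eqxx /flip /= eqxx => /(_ isT) AnS.
by tauto.
Qed.

(** The element [b i] and the position of [i] in its list determine [i]. This embeds [K] into
    [B * nat], hence into the infinite set [B]. *)
Lemma coarse_base_card S B : infinite_set [set: K] -> is_base (coarse S) B ->
  ([set: K] #<= B)%card.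
Proof.
move=> Kinf /base_finite_to_one[b [s bs]].
have Binf : infinite_set [set: B].
  rewrite (eq_finite_set (card_setT B)) => Bfin; apply: Kinf.
  apply: (sub_finite_set _ (bigcup_finite Bfin (fun b' _ => finite_seq (s b')))).
  by move=> i _; exists (b i); have [] := bs i.
have [j jinj] := infinite_injection Binf.
have [f finj] := injection_square _ jinj.
pose bB i : B := SigSub (mem_set (bs i).1).
rewrite -(card_le_eqr (card_setT B)).
apply: (card_le_injection (fun i => f (bB i, j (index i (s (b i)))))) => //.
move=> i i' _ _ /finj[bb' /jinj]; have {}bb' : b i = b i' := bb'.
rewrite -bb' => ii'; rewrite -(nth_index i (bs i).2) ii' nth_index //.
by rewrite bb'; exact: (bs i').2.
Qed.

Lemma coarse_weight S : infinite_set [set: K] -> weight_eq (coarse S) K.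
Proof.
move=> Kinf; split; last by move=> B; exact: coarse_base_card.
pose itv (ab : rat * rat) : set R := [set x | ratr ab.1 < x < ratr ab.2].
(* Rational intervals free of naturals serve the points that are not naturals; the shift [m.+2]
   meets the bound required by [coarse_basic]. *)
pose G (u : (rat * rat) + (nat * seq K * nat)) : set R := match u with
  | inl ab => if pselect (forall k : nat, ~ itv ab k%:R) then itv ab else set0
  | inr (k, s, m) => basic S k s m.+2 end.
have Gbase : is_base (coarse S) (range G).
  split=> [_ [[ab|[[k s] m]] _ <-]|U cU]; last first.
  - apply/seteqP; split=> [x Ux|x [b [_ bU] bx]]; last exact: bU.
    have [[k xk]|xN] := pselect (exists k : nat, x = k%:R).
      rewrite xk in Ux *; have [s [[|[|m]] [// _ mU]]] := basic_sub _ _ _ cU Ux.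
      by exists (basic S k s m.+2); [split=> //; exists (inr (k, s, m))|exact: basic_center].
    have oV : open (U `&` [set x : R | forall k : nat, x <> k%:R]).
      by apply: openI; [exact: coarse_open cU|exact: open_nat_free].
    have [|ab [xab abU]] := rat_itv_nbhs _ x oV.
      by split=> // k xk; apply: xN; exists k.
    exists (itv ab) => //; split; last by move=> y /abU[].
    exists (inl ab) => //=; case: pselect => // nab; case: nab => k /abU[_ kN]; exact: (kN k).
  - exact: (coarse_basic S k s m.+2 isT).
  - rewrite /G; case: pselect => /= kab; last by have [] := coarse_topology S.
    apply: coarse_nat_free => //; apply/openR => x /andP[ax xb].
    have [||r [r0 ra rb]] := lt_min_pos (x - ratr ab.1)%R (ratr ab.2 - x)%R; first by lra.
      by lra.
    exists r => // y; rewrite ltr_norml => /andP[? ?].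
    by apply/andP; split; lra.
exists (range G); split=> //; rewrite card_eq_le; apply/andP; split;
  last exact: (coarse_base_card S _ Kinf Gbase).
apply: card_le_trans (card_image_le _ _) _.
have [i iinj] := infinite_injection Kinf.
have [f finj] := injection_square _ iinj; have [g ginj] := injection_seq _ iinj.
have [q qinj] : exists q : rat * rat -> nat, injective q.
  by exists pickle; exact: pcan_inj pickleK.
(* The tags [i 0] and [i 1] keep the two kinds of indices apart inside [K]. *)
pose F (u : (rat * rat) + (nat * seq K * nat)) := match u with
  | inl ab => f (i 0, i (q ab))
  | inr (k, s, m) => f (i 1, f (g s, f (i k, i m))) end.
apply: (card_le_injection F) => //.
move=> [ab|[[k s] m]] [ab'|[[k' s'] m']] _ _ /finj[].
- by move=> /iinj/qinj->.
- by move=> /iinj.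
- by move=> /iinj.
- by move=> /finj[/ginj-> /finj[/iinj-> /iinj->]].
Qed.

(** * Homeomorphisms and rigidity *)

(* If [h x = k], a small Euclidean interval around [x] is sent into [basic S k [::] m];
   by connectedness it misses the clopen pieces around the points [n + 1/2]. *)
Lemma coarse_continuous S (h : R -> R) :
  (forall U, coarse S U -> open (h @^-1` U)) ->
  forall x e : R, 0 < e -> exists2 d : R, 0 < d & forall z, `|z - x| < d -> `|h z - h x| < e.
Proof.
move=> ho x e e0; have [[k hx]|hxN] := pselect (exists k : nat, h x = k%:R); last first.
  have [|d d0 dN] := not_nat_dist (h x); first by move=> k hx; apply: hxN; exists k.
  have [r [r0 rd re]] := lt_min_pos _ _ d0 e0.
  have cO : coarse S (thicken [set h x] r).
    apply: coarse_nat_free; first exact: open_thicken.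
    by move=> k [_ ->]; have := dN k; rewrite distrC; lra.
  have [|d' d'0 d'O] := (openR _).1 (ho _ cO) x.
    by exists (h x) => //; rewrite subrr normr0.
  by exists d' => // z /d'O [_ ->] /lt_trans; apply.
(* Centres are at least 1/2 apart, so radii below 1/6 leave the slack 1/6 used for [O2]. *)
have [|r [r0 re r6]] := lt_min_pos e (1/6)%R e0; first by lra.
have [m0 m0P] := tol_small _ r0; pose m := (m0 + 2)%N.
have mr : tol m < r by apply: m0P; rewrite leq_addr.
have m2 : (2 <= m)%N by rewrite leq_addl.
have cV : coarse S (basic S k [::] m) by exact: coarse_basic.
have [|d d0 dV] := (openR _).1 (ho _ cV) x; first by rewrite /preimage /= hx; exact: basic_center.
exists d => // z zx; rewrite hx.
have [y0 [->|[n tn <-]] hzy] := dV _ zx; first by lra.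
(* [O1] is the piece containing [h z] and [O2] the rest of the basic set; both are open in
   [coarse S]. *)
pose O1 := thicken [set (n%:R + 1/2)%R] (tol m).
pose O2 := basic S k [::] m `&` beyond [set (n%:R + 1/2)%R] (tol m).
have cO1 : coarse S O1.
  apply: coarse_nat_free => [|j [_ ->] jn]; first exact: open_thicken.
  by have := nat_half_dist j n; lra.
have cO2 : coarse S O2.
  have [_ _ cI _] := coarse_topology S; apply: cI => //.
  apply: (@coarse_cobounded _ _ (n%:R + 2)%R); first exact: open_beyond.
  by move=> w nw; exists 1 => // _ ->; rewrite ger0_norm; lra.
have O12 w : basic S k [::] m w -> ~ O1 w -> O2 w.
  move=> Vw O1w; split=> //; exists (1/6); first by lra.
  move=> _ ->; have [y [->|[n' tn' <-]] wy] := Vw.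
    have := nat_half_dist k n; have := ler_distD w k%:R (n%:R + 1/2).
    by rewrite (distrC _ w); lra.
  have [nn'|/eqP nn'] := eqVneq n n'.
    by exfalso; apply: O1w; rewrite /O1 nn'; exists (n'%:R + 1/2).
  have : ~ `|n%:R - n'%:R| < 1 :> R by move=> /natr_dist.
  move=> /negP; rewrite -leNgt => dnn'.
  have := ler_distD w (n%:R + 1/2) (n'%:R + 1/2); rewrite (distrC _ w).
  by rewrite (_ : n%:R + 1/2 - (n'%:R + 1/2) = n%:R - n'%:R :> R); [lra|ring].
exfalso; pose I := [set w : R | `|w - x| < d].
have /connected_intervalP cI : is_interval I.
  move=> u v; rewrite /I /= !ltr_norml => /andP[xu ux] /andP[xv vx] w /andP[uw wv].
  by rewrite /I /= ltr_norml; apply/andP; split; lra.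
have IO1 : I `&` h @^-1` O1 = I.
  apply: cI.
  - by exists z; split=> //; exists (n%:R + 1/2).
  - by exists (h @^-1` O1) => //; exact: ho.
  - exists (~` (h @^-1` O2)); first by apply: open_closedC; exact: ho.
    apply/seteqP; split=> w [Iw Ow]; split=> //.
      by move=> O2w; have : (O1 `&` beyond [set (n%:R + 1/2)%R] (tol m)) (h w);
        [split=> //; case: O2w|rewrite thicken_beyond].
    by apply: contrapT => O1w; apply: Ow; apply: O12 => //; exact: dV.
have : (I `&` h @^-1` O1) x by rewrite IO1 /I /= subrr normr0.
move=> [_ [_ ->]]; rewrite hx.
by have := nat_half_dist k n; lra.
Qed.

Lemma continuous_inj_mono (h : R -> R) :
  (forall x e : R, 0 < e -> exists2 d : R, 0 < d & forall z, `|z - x| < d -> `|h z - h x| < e) ->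
  injective h -> {mono h : x y / x <= y} \/ {mono h : x y /~ x <= y}.
Proof.
move=> hc hinj.
have /itv_continuous_inj_mono : {within [set` `]-oo, +oo[ ], continuous h}.
  apply: continuous_subspaceT => x U /nbhs_ballP[e /= e0 eU].
  have [d d0 dP] := hc x e e0; apply/nbhs_ballP; exists d => //= z.
  by rewrite /ball /= distrC => /dP; rewrite distrC; exact: eU.
case=> [x y _ _|hm|hm]; first exact: hinj.
  by left; apply: le_mono => x y; apply: hm; rewrite in_itv.
by right; apply: le_nmono => x y; apply: hm; rewrite in_itv.
Qed.

(* A neighbourhood of [h k] free of naturals and mapped by [g] near [k] would be
   open, but its preimage must contain points [n + 1/2] far from [k]. *)
Lemma homeo_nat S S' (h g : R -> R) : cancel h g ->
  (forall U, coarse S' U -> coarse S (h @^-1` U)) ->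
  (forall U, coarse S U -> coarse S' (g @^-1` U)) ->
  forall k : nat, exists j : nat, h k%:R = j%:R.
Proof.
move=> hK hc gc k; apply: contrapT => /forallNP hkN.
have [e e0 eN] := not_nat_dist _ hkN.
have [|d d0 dP] := coarse_continuous S g (fun U cU => (gc U cU).1) (h k%:R) (1/2)%R; first by lra.
have [r [r0 re rd]] := lt_min_pos _ _ e0 d0.
have cO : coarse S' (thicken [set h k%:R] r).
  apply: coarse_nat_free; first exact: open_thicken.
  by move=> j [_ ->]; have := eN j; rewrite distrC; lra.
have [|s [m smP]] := (hc _ cO).2 k; first by exists (h k%:R); rewrite // subrr normr0.
have [n tn] := independent k s S m.
have [_ -> hn] := smP _ (half_thicken _ _ _ _ _ tn).
have := dP _ (lt_trans hn rd); rewrite !hK distrC.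
by have := nat_half_dist k n; lra.
Qed.

Lemma increasing_nat_ge (h : R -> R) : {mono h : x y / x <= y} ->
  (forall k : nat, exists j : nat, h k%:R = j%:R) -> forall k : nat, k%:R <= h k%:R.
Proof.
move=> hm hN; elim=> [|k IHk]; first by have [j ->] := hN 0%N; rewrite ler0n.
have : h k%:R < h k.+1%:R by rewrite (leW_mono hm) ltr_nat.
move: IHk; have [j ->] := hN k; have [j' ->] := hN k.+1.
by rewrite !ler_nat ltr_nat => /leq_ltn_trans; apply.
Qed.

(** A decreasing [h] would drop by at least 1 at each natural, falling below 0 after [h 0] steps. *)
Lemma nat_stable_not_decreasing (h : R -> R) :
  (forall k : nat, exists j : nat, h k%:R = j%:R) ->
  ~ {mono h : x y /~ x <= y}.
Proof.
move=> hN hm; have [j0 h0] := hN 0%N.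
have drop (k : nat) : exists j : nat, h k%:R = j%:R /\ (j + k <= j0)%N.
  elim: k => [|k [j [hk jk]]]; first by exists j0; rewrite addn0.
  have : h k.+1%:R < h k%:R by rewrite (leW_nmono hm) ltr_nat.
  have [j' hk1] := hN k.+1; rewrite hk hk1 ltr_nat => j'j.
  by exists j'; split=> //; rewrite addnS (leq_trans _ jk) // -addSn leq_add2r.
by have [j [_]] := drop j0.+1; lia.
Qed.

Lemma coarse_rigid S S' : homeomorphic (coarse S) (coarse S') -> S = S'.
Proof.
move=> [h [g [hK gK hc gc]]].
have hN := homeo_nat _ _ _ _ hK hc gc; have gN := homeo_nat _ _ _ _ gK gc hc.
have hm : {mono h : x y / x <= y}.
  have [//|/(nat_stable_not_decreasing _ hN)//] := continuous_inj_mono h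
    (coarse_continuous S' h (fun U cU => (hc U cU).1)) (can_inj hK).
have gm : {mono g : x y / x <= y} by move=> x y; rewrite -hm !gK.
(* The lower bound for [h] gives [k <= h k]; the one for [g] at [j = h k] gives the converse. *)
have hnat (k : nat) : h k%:R = k%:R.
  apply/eqP; rewrite eq_le (increasing_nat_ge _ hm hN) andbT.
  have [j hj] := hN k; have := increasing_nat_ge _ gm gN j.
  by rewrite hj -hj hK hj.
apply/seteqP; suff SS i : S i <-> S' i by split=> i /SS.
have c2 : coarse S' (basic S' 0 [:: i] 2) by exact: coarse_basic.
have [|s [m smP]] := (hc _ c2).2 0%N; first by rewrite /preimage /= hnat; exact: basic_center.
have [n [mn cn AS]] := independent 0 (i :: s) S (maxn m 1).
have n0 : (0 < n)%N by rewrite (leq_trans _ mn) // leq_maxr.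
have tn : tail S 0 s m n.
  split=> [|//|j js]; first by rewrite (leq_trans _ mn) // leq_maxl.
  by apply: AS; rewrite inE js orbT.
(* As [h] fixes [n] and [n + 1], the half-integer stays in its cell, where [basic_tail] reads off
   [A i n <-> S' i]. *)
have hn : n%:R < h (n%:R + 1/2) < n.+1%:R.
  have /andP[nx xn] := half_itv n _ erefl.
  by apply/andP; split; [rewrite -{1}(hnat n)|rewrite -(hnat n.+1)]; rewrite (leW_mono hm).
have [//|_ _ /(_ i)] := basic_tail _ _ _ _ _ _ _ n0 hn (smP _ (half_thicken _ _ _ _ _ tn)).
rewrite inE eqxx => /(_ isT) <-; have := AS i; rewrite inE eqxx => /(_ isT) ->.
by [].
Qed.

End CoarseTopology.

(* The infinite cardinal kappa <= c is represented as the cardinality of a type K. *)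
Theorem theorem10 (K : Type) :
  infinite_set [set: K] -> ([set: K] #<= [set: R])%card ->
  exists TT : set (set (set R)),
    [/\ TT `<=` in_L,
        (TT #= [set: set K])%card,
        (forall tau, TT tau ->
           [/\ completely_normal tau, baire tau & weight_eq tau K]) &
        (forall tau tau', TT tau -> TT tau' -> tau <> tau' ->
           ~ homeomorphic tau tau')].
Proof.
move=> Kinf /pcard_injP[e e_inj].
have [|c [A indep]] := @independent_family {classic K} e.
  by move=> i j; apply: e_inj; rewrite in_setT.
have rigid := coarse_rigid c A indep.
exists (range (coarse c A)); split.
- by move=> _ [S _ <-]; exact: coarse_in_L.
(* Equal topologies are homeomorphic by the identity, so rigidity also gives injectivity of
   [coarse c A]. *)
- apply: inj_card_eq => S S' _ _ SS'; apply: rigid; rewrite SS'.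
  by exists id, id.
- move=> _ [S _ <-]; split; [exact: coarse_completely_normal|exact: coarse_baire|].
  exact: coarse_weight.
- by move=> _ _ [S _ <-] [S' _ <-] SS' /rigid E; apply: SS'; rewrite E.
Qed.
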